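(* Let $q$ and $r$ be distinct primes. Let $G$ be a primitive subgroup of the symmetric group $S_n$ which is in $\mathfrak{A}_q\mathfrak{A}_r$, and let $|G| = q^\beta r^\gamma$ where $\beta,\gamma\in\mathbb{N}$. Let $M$ be a minimal normal subgroup of $G$. (i) If $\beta = 0$, then $|M|$ is a power of $r$ and $|G| = n = r$ with $G \cong C_r$. (ii) If $\beta \geq 1$, then $|M| = q^{\beta} = n$, and $\beta$ is the multiplicative order of $q$ modulo $r$. Further $G \cong M \rtimes C_r$ and $|G| = nr < n^{2}$. (iii) If $\gamma = 0$, then $|M|$ is a power of $q$ and $|G| = n = q$ with $G\cong C_q$.
   Context: The convention $0\in\mathbb{N}$ is used. $C_m$ denotes the cyclic group of order $m$. For distinct primes $q,r$, $\mathfrak{A}_q\mathfrak{A}_r$ is the variety of all groups $G$ having an abelian normal subgroup $N$ of exponent dividing $q$ such that $G/N$ is abelian of exponent dividing $r$. A subgroup of $S_n$ is primitive if it is transitive on the $n$ points and preserves no partition of them other than the partition into singletons and the partition with one block.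
   Formalization: Part (ii) is stated for β ≥ 1 and γ ≥ 1; with γ = 0 it fails (e.g. q = 2, r = 3, G = S_2, n = 2 has |G| = 2, not nr = 6), and that case is covered by part (iii). *)

(* Defs.v *)
From mathcomp Require Import all_boot all_order all_fingroup all_algebra all_solvable.

Set Implicit Arguments.
Unset Strict Implicit.
Unset Printing Implicit Defensive.

Local Open Scope group_scope.

(* Membership of the finite group G in the product variety A_q A_r:
   abelian of exponent dividing q, by abelian of exponent dividing r. *)
Definition in_AqAr (gT : finGroupType) (q r : nat) (G : {group gT}) : Prop :=
  exists N : {group gT},
    [/\ N <| G, abelian N, exponent N %| q,
        abelian (G / N) & exponent (G / N) %| r].

(* [minnormal M G] alone only says that M is minimal among the nontrivial
   groups normalised by G; it does not force M to lie in G. *)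
Definition is_min_normal_subgroup (gT : finGroupType) (M G : {group gT}) : Prop :=
  M \subset G /\ minnormal M G.

(* m is the multiplicative order of q modulo r, i.e. the order of the class of
   q in the unit group of Z/r. Only meaningful for 1 < r, since 'Z_0 and 'Z_1
   are both Z/2. *)
Definition is_mult_order (q r m : nat) : Prop :=
  exists2 u : {unit 'Z_r}, val u = (q%:R)%R & #[u] = m.

(* Main.v *)
(* Let N be the abelian normal subgroup of exponent dividing q.  If N is
   nontrivial it is transitive, hence regular, and a point stabiliser H is a
   complement isomorphic to G / N.  When q and r both divide |G|, N is the
   normal Sylow q-subgroup and equals M by comparing orders; H acts faithfully
   and irreducibly on it, so H is cyclic by Schur's lemma, of order r.  Since H
   fixes only 1 in N, r divides q^beta - 1; conversely, if q^d = 1 mod r then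
   every element of the field F_q[H] acting on N is a root of X^(q^d) - X,
   whence beta <= d.  If only one prime divides |G|, then G is abelian with
   trivial, and maximal, point stabilisers, so of prime order. *)
Require Import Defs.
From mathcomp Require Import all_boot all_order all_fingroup all_algebra all_solvable.
From mathcomp Require Import finfield mxrepresentation mxabelem.

Set Implicit Arguments.
Unset Strict Implicit.
Unset Printing Implicit Defensive.

Local Open Scope group_scope.

(** * Counting polynomial roots in commutative matrix algebras *)

Section CommutingRoots.
Import GRing.Theory.
Local Open Scope ring_scope.

(** Supplies the [uniq_roots] condition, under which a nonzero polynomial over a noncommutative ring
    has fewer roots than its size. *)
Lemma uniq_roots_comm_unit (R : unitRingType) (s : seq R) :
    {in s &, forall x y, x * y = y * x} ->
    {in s &, forall x y, x != y -> y - x \is a GRing.unit} ->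
  uniq s -> uniq_roots s.
Proof.
elim: s => //= x s IHs comm_s unit_s /andP[s'x uniq_s]; apply/andP; split.
  apply/allP=> y s_y; rewrite /diff_roots.
  rewrite comm_s ?inE ?eqxx ?s_y ?orbT //= unit_s ?inE ?eqxx ?s_y ?orbT //.
  by apply: contraNneq s'x => ->.
by apply: IHs => // y z sy sz; [apply: comm_s | apply: unit_s];
  rewrite inE ?sy ?sz orbT.
Qed.

Lemma exprD_comm_pchar (R : nzSemiRingType) (p k : nat) (x y : R) :
    p \in [pchar R] -> x * y = y * x ->
  (x + y) ^+ (p ^ k) = x ^+ (p ^ k) + y ^+ (p ^ k).
Proof.
move=> pcharRp cxy; elim: k => [|k IHk]; first by rewrite !expr1.
rewrite expnSr !exprM IHk.
rewrite -!(pFrobenius_autE pcharRp) pFrobenius_autD_comm //.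
exact/commrX/commr_sym/commrX.
Qed.

(* The enveloping algebra E is commutative, spanned by matrices fixed by the
   q-th power map, q = p ^ d, which is additive and F_p-linear on E; so each
   element of E is a root of X^q - X. By Schur E is a field, so there are at
   most q such roots, while E has at least p ^ n.+1 elements since it moves a
   nonzero vector onto any vector. *)
Lemma abelian_mx_irr_degree_le (p : nat) (gT : finGroupType) (H : {group gT})
    (n : nat) (rH : mx_representation 'F_p H n.+1) (d : nat) :
    prime p -> abelian H -> mx_irreducible rH -> (0 < d)%N ->
    (p ^ d)%N = 1%N %[mod exponent H] ->
  (n.+1 <= d)%N.
Proof.
move=> p_pr abH irrH d_gt0 pd1.
have p_gt1 := prime_gt1 p_pr.
have pcharM: p \in [pchar 'M['F_p]_n.+1] by rewrite pchar_lalg pchar_Fp.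
have centE A: (A \in enveloping_algebra_mx rH)%MS -> centgmx rH A.
  case/envelop_mxP=> a ->; apply/centgmxP=> y Hy.
  rewrite mulmx_suml mulmx_sumr; apply: eq_bigr => x Hx.
  by rewrite -scalemxAl -scalemxAr -!repr_mxM // (centsP abH x Hx y Hy).
have commE A B: (A \in enveloping_algebra_mx rH)%MS ->
    (B \in enveloping_algebra_mx rH)%MS -> A * B = B * A.
  move=> /centE/centgmxP cA /envelop_mxP[b ->].
  rewrite mulr_sumr mulr_suml; apply: eq_bigr => x Hx.
  by rewrite -scalerAl -scalerAr; congr (_ *: _); apply: cA.
have rootE A: (A \in enveloping_algebra_mx rH)%MS -> A ^+ (p ^ d) = A.
  case/envelop_mxP=> a ->.
  pose fixE (B : 'M_n.+1) :=
    (B \in enveloping_algebra_mx rH)%MS /\ B ^+ (p ^ d) = B.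
  suffices [] : fixE (\sum_(x in H) a x *: rH x) by [].
  apply: (big_ind fixE) => [|B C [EB fixB] [EC fixC]|x Hx].
  - by split; rewrite ?linear0 ?sub0mx // expr0n expn_eq0 eqn0Ngt prime_gt0.
  - split; first by rewrite linearD addmx_sub.
    by rewrite (exprD_comm_pchar d pcharM (commE _ _ EB EC)) fixB fixC.
  (* The scalar is fixed by Fermat, and [rH x] because the order of [x] divides [p ^ d - 1]. *)
  split; first by rewrite linearZ scalemx_sub ?envelop_mx_id.
  rewrite exprZn -repr_mxX //; congr (_ *: rH _).
    elim: (d) => [|k IHk]; first by rewrite expr1.
    rewrite expnSr exprM IHk.
    by have:= expf_card (a x); rewrite card_Fp.
  apply/eqP; rewrite -{2}[x]expg1 eq_expg_mod_order.
  by rewrite -(modn_dvdm (p ^ d) (dvdn_exponent Hx)) pd1 modn_dvdm ?dvdn_exponent.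
(* Any nonzero vector would do: irreducibility makes it generate the module. *)
pose v : 'rV['F_p]_n.+1 := const_mx 1.
have nz_v: v != 0.
  by apply/eqP=> /rowP/(_ 0) /eqP; rewrite !mxE oner_eq0.
have toE (w : 'rV_n.+1) :
    exists A, (A \in enveloping_algebra_mx rH)%MS && (w == v *m A).
  have: (w <= cyclic_mx rH v)%MS.
    by rewrite -(mxsimple_cyclic irrH nz_v) ?submx1.
  by case/cyclic_mxP=> A EA ->; exists A; rewrite EA eqxx.
(* [phi w] carries [v] to [w], so [phi] is injective and yields [p ^ n.+1] distinct elements of the
   algebra. *)
pose phi w := xchoose (toE w).
have Ephi w: (phi w \in enveloping_algebra_mx rH)%MS.
  by have /andP[] := xchooseP (toE w).
have phiE w: w = v *m phi w by have /andP[_ /eqP] := xchooseP (toE w).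
have inj_phi: injective phi by move=> w1 w2 eq12; rewrite (phiE w1) eq12 -phiE.
pose rs := [seq phi w | w : 'rV['F_p]_n.+1].
have size_rs: size rs = (p ^ n.+1)%N.
  by rewrite size_map -cardT card_mx card_Fp // mul1n.
have q_gt1: (1 < p ^ d)%N by rewrite -(expn0 p) ltn_exp2l.
pose f : {poly 'M['F_p]_n.+1} := 'X^(p ^ d) - 'X.
have size_f: size f = (p ^ d).+1.
  by rewrite size_polyDl size_polyXn // size_polyN size_polyX ltnS.
have: (size rs < size f)%N.
  apply: max_ring_poly_roots; first by rewrite -size_poly_eq0 size_f.
    apply/allP=> _ /mapP[w _ ->]; rewrite /root !hornerE hornerXn.
    by rewrite rootE ?Ephi ?subrr.
  apply: uniq_roots_comm_unit; last by rewrite map_inj_uniq ?enum_uniq.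
    by move=> _ _ /mapP[w1 _ ->] /mapP[w2 _ ->]; apply: commE.
  move=> _ _ /mapP[w1 _ ->] /mapP[w2 _ ->] ne12.
  apply: (mx_Schur irrH); last by rewrite subr_eq0 eq_sym.
  by apply: centE; rewrite linearB addmx_sub ?eqmx_opp; try exact: Ephi.
by rewrite size_rs size_f ltnS leq_exp2l.
Qed.

End CommutingRoots.

(** * Primitive permutation groups and regular abelian subgroups *)

Section PrimitivePermutationGroups.
Variables (T : finType).
Implicit Types (G A N : {group {perm T}}) (x : T).

(** Since [a] commutes with [A], it fixes every image of [x] under [A], hence every point. *)
Lemma cent_trans_fix1 A x (a : {perm T}) :
  [transitive A, on [set: T] | 'P] -> a \in 'C(A) -> a x = x -> a = 1.
Proof.
move=> trA cAa ax; apply/permP=> y; rewrite perm1.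
have /orbitP[b Ab <-]: y \in orbit 'P A x by rewrite (atransP trA) ?inE.
by rewrite /= apermE -permM -(centP cAa b Ab) permM ax.
Qed.

Lemma trans_abelian_stab1 A x :
  [transitive A, on [set: T] | 'P] -> abelian A -> 'C_A[x | 'P] = 1.
Proof.
move=> trA abA; apply/trivgP/subsetP=> a /setIP[Aa /astab1P ax]; rewrite inE.
by apply/eqP/(cent_trans_fix1 (x := x) trA) => //; apply: subsetP Aa.
Qed.

Lemma trans_abelian_card A :
  [transitive A, on [set: T] | 'P] -> abelian A -> #|A| = #|T|.
Proof.
move=> trA abA; have [x _ defT] := imsetP trA.
rewrite -cardsT defT -(card_orbit_stab 'P A x).
by rewrite trans_abelian_stab1 // cards1 muln1.
Qed.

Lemma prim_normal_trans G N :
    [primitive G, on [set: T] | 'P] -> N <| G -> N :!=: 1 ->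
  [transitive N, on [set: T] | 'P].
Proof.
move=> primG nsNG ntN; have [fixN|//] := prim_trans_norm primG nsNG.
by case/eqP: ntN; apply/trivgP; apply: subset_trans fixN (aperm_faithful G).
Qed.

(** Primitivity makes the trivial point stabiliser maximal, so any element of prime order generates
    [G]. *)
Lemma prim_abelian_prime G :
    [primitive G, on [set: T] | 'P] -> abelian G -> G :!=: 1 ->
  prime #|G| /\ #|G| = #|T|.
Proof.
move=> primG abG ntG; have [trG _] := andP primG.
split; last exact: trans_abelian_card.
have [x _ _] := imsetP trG.
have oC1 := trans_abelian_stab1 x trG abG.
have:= primG; rewrite (trans_prim_astab (in_setT x) trG).
case/maximal_eqP=> _ maxC.
have p_pr: prime (pdiv #|G|) by rewrite pdiv_prime // cardG_gt1.
have [a Ga oa] := Cauchy p_pr (pdiv_dvd _).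
have [|| a1 | <-] := maxC <[a]>%G; rewrite ?cycle_subG //=.
- by rewrite oC1 sub1G.
- by move: p_pr; rewrite -oa /order a1 /= oC1 cards1.
by rewrite -orderE oa.
Qed.

End PrimitivePermutationGroups.

(** * Abelian groups of prime exponent and coprime linear action *)

Lemma prime_card_isog_Zp (gT : finGroupType) (G : {group gT}) (p : nat) :
  prime p -> #|G| = p -> G \isog Zp p.
Proof.
move=> p_pr oG; have oZp: #|Zp p| = p by rewrite card_Zp ?prime_gt0.
by rewrite isog_cyclic_card !prime_cyclic ?oZp ?oG ?eqxx.
Qed.

Lemma pgroup_exponent_dvd (gT : finGroupType) (G : {group gT}) (p : nat) :
  prime p -> exponent G %| p -> p.-group G.
Proof.
by move=> p_pr expG; rewrite -pnat_exponent (pnat_dvd expG) ?pnat_id.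
Qed.

(** Serves both extreme cases: [p = r] when [beta = 0], and [p = q] when [gamma = 0]. *)
Lemma prim_abelian_exponent (p n : nat) (G M : {group 'S_n}) :
    prime p -> [primitive G, on [set: 'I_n] | 'P] -> abelian G ->
    exponent G %| p -> M \subset G -> M :!=: 1 ->
  [/\ exists k : nat, #|M| = (p ^ k)%N, #|G| = n, n = p & G \isog Zp p].
Proof.
move=> p_pr primG abG expG sMG ntM.
have ntG: G :!=: 1 by apply: contraNneq ntM => G1; rewrite -subG1 -G1.
have pG := pgroup_exponent_dvd p_pr expG.
have [prG oG] := prim_abelian_prime primG abG ntG; rewrite card_ord in oG.
have oGp: #|G| = p.
  have [_ p_dv _] := pgroup_pdiv pG ntG.
  by apply/eqP; rewrite eq_sym -dvdn_prime2.
split; rewrite -?oG //; last exact: prime_card_isog_Zp.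
by have [k oM] := p_natP (pgroupS sMG pG); exists k.
Qed.

(** Solvability makes [M] elementary abelian and primitivity makes it transitive, so it is
    regular. *)
Lemma prim_solvable_minnormal_card (T : finType) (G M : {group {perm T}}) :
    [primitive G, on [set: T] | 'P] -> solvable G ->
    M \subset G -> minnormal M G ->
  #|M| = #|T|.
Proof.
move=> primG solG sMG minM.
have [nMG ntM /is_abelemP[p p_pr abelM]] := minnormal_solvable minM sMG solG.
apply: trans_abelian_card (abelem_abelian abelM).
by apply: prim_normal_trans primG _ ntM; apply/andP.
Qed.

Lemma minnormal_coprime_order (gT : finGroupType) (H N : {group gT}) (q r : nat) :
    prime q -> prime r -> q <> r -> q.-abelem N -> minnormal N H ->
    abelian H -> exponent H %| r -> H :!=: 1 -> 'C_H(N) = 1 ->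
  [/\ #|H| = r, r %| #|N|.-1 & is_mult_order q r (logn q #|N|)].
Proof.
move=> q_pr r_pr qr abelN minN abH expH ntH cHN1.
have /mingroupP[/andP[ntN nNH] minN'] := minN.
have r_gt1 := prime_gt1 r_pr; have rH := pgroup_exponent_dvd r_pr expH.
have irrN := elimT (abelem_mx_irrP abelN ntN nNH) minN.
have ffulN := abelem_mx_faithful abelN ntN nNH cHN1.
have cycH := mx_faithful_irr_abelian_cyclic ffulN irrN abH.
have oH: #|H| = r.
  move: expH; rewrite exponent_cyclic //.
  have [_ r_dv _] := pgroup_pdiv rH ntH.
  by move=> dv_r; apply/eqP; rewrite eqn_dvd dv_r.
have oN: #|N| = (q ^ logn q #|N|)%N by apply: card_pgroup (abelem_pgroup abelN).
have N_mod: #|N| = 1%N %[mod r].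
  have actsHN: [acts H, on N | 'J] by rewrite astabsJ.
  rewrite (pgroup_fix_mod rH actsHN) afixJ.
  (* [H] normalises these fixed points; were they nontrivial, minimality would make them all of [N],
     against faithfulness. *)
  suffices ->: 'C_N(H) = 1 by rewrite cards1.
  apply/eqP; apply: contraT => ntC.
  have CN: 'C_N(H)%G = N.
    apply/val_inj/minN'; rewrite ?subsetIl // ntC normsI ?norms_cent ?normG //.
  case/eqP: ntH; rewrite -cHN1; apply/esym/setIidPl.
  by rewrite centsC -CN subsetIr.
have co_rq: coprime r q by rewrite prime_coprime // dvdn_prime2 // eq_sym; apply/eqP.
have Uq: (q%:R : 'Z_r)%R \is a GRing.unit by rewrite unitZpE.
pose u : {unit 'Z_r} := FinRing.unit 'Z_r Uq.
have uX k : (u ^+ k == 1) = (q ^ k == 1 %[mod r]).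
  rewrite -val_eqE /= FinRing.val_unitX /= -GRing.natrX.
  by rewrite -val_eqE /= (val_Zp_nat r_gt1) (modn_small r_gt1).
have logN_gt0: 0 < logn q #|N|.
  have [_ q_dv _] := pgroup_pdiv (abelem_pgroup abelN) ntN.
  by rewrite logn_gt0 mem_primes q_pr cardG_gt0 q_dv.
split=> //; first by rewrite -subn1 -eqn_mod_dvd ?cardG_gt0 // N_mod.
(* The order of [u] divides [logn q #|N|] because [#|N|] is 1 mod [r]; the reverse inequality is the
   degree bound at [d = #[u]]. *)
exists u => //; apply/eqP; rewrite eqn_leq dvdn_leq //=; last first.
  by rewrite order_dvdn uX -oN N_mod.
rewrite -(dim_abelemE abelN ntN).
apply: (abelian_mx_irr_degree_le q_pr abH irrN (order_gt0 u)).
rewrite exponent_cyclic // oH; apply/eqP.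
by rewrite -uX expg_order.
Qed.

(** * The case where both primes divide the order, and the theorem *)

Lemma primitive_AqAr_mixed (T : finType) (q r : nat) (G M : {group {perm T}}) :
    prime q -> prime r -> q <> r -> [primitive G, on [set: T] | 'P] ->
    in_AqAr q r G -> is_min_normal_subgroup M G -> q %| #|G| -> r %| #|G| ->
  [/\ q.-abelem M, #|M| = #|T|, r %| #|M|.-1, is_mult_order q r (logn q #|M|) &
      exists2 H : {group {perm T}}, M ><| H = G & #|H| = r].
Proof.
move=> q_pr r_pr qr primG [N [nsNG abN expN abGN expGN]] [sMG minM] qG rG.
have [sNG nNG] := andP nsNG; have [trG _] := andP primG.
have qN := pgroup_exponent_dvd q_pr expN.
have rGN := pgroup_exponent_dvd r_pr expGN.
have r_q' : {subset (r : nat_pred) <= q^'}.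
  by move=> p /eqnP->; rewrite !inE eq_sym; apply/eqP.
have hallN: q.-Hall(G) N.
  rewrite /pHall sNG qN -card_quotient //.
  exact: sub_pgroup r_q' rGN.
have ntN: N :!=: 1.
  apply: contraTneq qG => N1; rewrite -p'natE //.
  by have /and3P[_ _] := hallN; rewrite N1 indexg1.
have oN: #|N| = #|T| by apply/trans_abelian_card/abN/(prim_normal_trans primG).
have solG: solvable G by rewrite (series_sol nsNG) !abelian_sol.
have oM: #|M| = #|T| by apply: prim_solvable_minnormal_card minM.
(* Having the order of [N], [M] is a [q]-group, so it lies in the normal Hall subgroup [N]. *)
have defM: M = N.
  apply/val_inj/eqP; rewrite /= eqEcard oM oN leqnn andbT.
  by rewrite (sub_normal_Hall hallN) // /pgroup oM -oN.
rewrite {M sMG oM}defM in minM *.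
have /mingroupP[/andP[_ nNG'] minN] := minM.
have abelN: q.-abelem N by rewrite abelemE ?abN.
have trN := prim_normal_trans primG nsNG ntN.
have [x _ _] := imsetP trG.
pose H := 'C_G[x | 'P]%G.
have sHG : H \subset G by apply: subsetIl.
have fixH a : a \in H -> a \in 'C(N) -> a = 1.
  by case/setIP=> _ /astab1P ax cNa; apply: cent_trans_fix1 trN cNa ax.
have tiNH: N :&: H = 1.
  apply/trivgP/subsetP=> a /setIP[Na Ha]; rewrite inE; apply/eqP/fixH => //.
  exact: subsetP Na.
have cHN1: 'C_H(N) = 1.
  apply/trivgP/subsetP=> a /setIP[Ha cNa]; rewrite inE; exact/eqP/fixH.
have defG: N * H = G.
  rewrite -normC ?(subset_trans sHG) //.
  by apply/(subgroup_transitiveP (in_setT x) sNG trG).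
have sdG: N ><| H = G by rewrite sdprodE // (subset_trans sHG).
have isoH: H \isog G / N.
  by rewrite -defG quotientMidl quotient_isog // (subset_trans sHG).
(* A subgroup of the abelian [N] is normalised by [N], so if [H] normalises it, so does
   [G = N * H]. *)
have minH: minnormal N H.
  apply/mingroupP; rewrite ntN (subset_trans sHG) //; split=> // K.
  case/andP=> ntK nKH sKN; apply: minN => //.
  rewrite ntK -defG mul_subG // cents_norm //.
  exact: subset_trans abN (centS sKN).
have ntH: H :!=: 1.
  apply: contraTneq rG => H1.
  rewrite -p'natE // -defG H1 mulg1; apply: sub_pgroup qN => p /eqnP->.
  by rewrite !inE; apply/eqP.
have [] := minnormal_coprime_order q_pr r_pr qr abelN minH _ _ ntH cHN1.
- by rewrite (isog_abelian isoH).
- by rewrite (exponent_isog isoH).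
by move=> oH r_dv ord; split=> //; exists H.
Qed.

(** Part (ii) asks for [gamma >= 1]: when [gamma = 0], part (iii) gives [#|G| = n], which is not
    [n * r]. *)
Theorem theoremB (q r : nat) (q_pr : prime q) (r_pr : prime r) (qr : q <> r)
    (n : nat) (G : {group 'S_n})
    (primG : [primitive G, on [set: 'I_n] | 'P])
    (GAqAr : in_AqAr q r G)
    (beta gamma : nat) (oG : #|G| = (q ^ beta * r ^ gamma)%N)
    (M : {group 'S_n}) (minM : is_min_normal_subgroup M G) :
  [/\ beta = 0%N ->
        [/\ exists k : nat, #|M| = (r ^ k)%N, #|G| = n, n = r & G \isog Zp r],
      (1 <= beta)%N -> (1 <= gamma)%N ->
        [/\ #|M| = (q ^ beta)%N /\ (q ^ beta)%N = n,
            is_mult_order q r beta,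
            exists2 H : {group 'S_n}, M ><| H = G & H \isog Zp r,
            #|G| = (n * r)%N &
            (n * r < n ^ 2)%N]
    & gamma = 0%N ->
        [/\ exists k : nat, #|M| = (q ^ k)%N, #|G| = n, n = q & G \isog Zp q]].
Proof.
have [sMG minMG] := minM; have /mingroupP[/andP[ntM _] _] := minMG.
split=> [beta0 | beta_gt0 gamma_gt0 | gamma0].
- have [N [nsNG _ expN abGN expGN]] := GAqAr; have [sNG nNG] := andP nsNG.
  (* [N] is a [q]-group whose order divides a power of [r]. *)
  have N1: N :=: 1.
    apply: card1_trivg; apply: (@pnat_1 q).
      exact: pgroup_exponent_dvd expN.
    apply: pnat_dvd (cardSg sNG) _.
    rewrite oG beta0 mul1n pnatX pnatE // !inE eq_sym.
    by apply/orP; left; apply/eqP.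
  have isoG: G \isog G / N by rewrite quotient_isog // N1 setI1g.
  apply: prim_abelian_exponent => //; first by rewrite (isog_abelian isoG).
  by rewrite (exponent_isog isoG).
- have q_dv: q %| #|G| by rewrite oG dvdn_mulr ?dvdn_exp.
  have r_dv: r %| #|G| by rewrite oG dvdn_mull ?dvdn_exp.
  have [abelM oM r_dv1 ord [H defG oH]] :=
    primitive_AqAr_mixed q_pr r_pr qr primG GAqAr minM q_dv r_dv.
  rewrite card_ord in oM.
  have oGn: #|G| = (n * r)%N by rewrite -(sdprod_card defG) oM oH.
  have oMq := card_pgroup (abelem_pgroup abelM).
  (* Compare the exponents of [q] in [#|M| * r = q ^ beta * r ^ gamma]. *)
  have logM: logn q #|M| = beta.
    have lq_r: logn q r = 0.
      by rewrite logn_coprime // prime_coprime // dvdn_prime2 //; apply/eqP.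
    have:= congr1 (logn q) (etrans (sdprod_card defG) oG).
    rewrite !lognM ?cardG_gt0 ?expn_gt0 ?prime_gt0 // oH !lognX lq_r.
    by rewrite muln0 !addn0 (logn_prime q q_pr) eqxx muln1.
  rewrite logM in oMq ord.
  split=> //; first by rewrite -oMq oM.
    by exists H => //; apply: prime_card_isog_Zp.
  (* The bound reduces to [r < n], which holds as [r] divides the positive number [n - 1]. *)
  have n_gt1: 1 < n by rewrite -oM cardG_gt1.
  rewrite -mulnn ltn_pmul2l ?(ltnW n_gt1) //.
  rewrite -(ltn_predK n_gt1) ltnS dvdn_leq //; last by rewrite -oM.
  by rewrite -subn1 subn_gt0.
- have [N [nsNG abN expN _ expGN]] := GAqAr; have [sNG nNG] := andP nsNG.
  have GN: G :=: N.
    have GN1: G / N = 1.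
      apply: card1_trivg; apply: (@pnat_1 r).
        exact: pgroup_exponent_dvd expGN.
      apply: pnat_dvd (dvdn_quotient _ _) _.
      rewrite oG gamma0 muln1 pnatX pnatE // !inE.
      by apply/orP; left; apply/eqP.
    by apply/eqP; rewrite eqEsubset sNG andbT -quotient_sub1 // GN1.
  by apply: prim_abelian_exponent => //; rewrite GN.
Qed.
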